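(* Let $\mathcal G$ be the graph with vertex set $V=(\mathbb{N}\times\mathbb{N})\setminus\{(0,0)\}$ (where $\mathbb{N}=\{0,1,2,\dots\}$), in which two distinct vertices $(a,b),(c,d)$ are adjacent if and only if $a=c=0$, or $b=d=0$, or ($a<c$ and $b>d$), or ($a>c$ and $b<d$). Then $\rho(\mathcal G)=\omega$; that is, $\omega$ is a CR-ordinal.
   Context: Game of cops and robbers: on a graph $G$, the cop picks a start vertex, then the robber; they then alternately move (cop first) to an adjacent vertex or stay put; the cop wins if he lands on the robber's vertex; $G$ is cop-win if the cop has a winning strategy. Ordinal capture times: let $G$ be a graph of cardinality $\aleph_\beta$, let $\omega(G)=\omega_{\beta+1}$, and for a vertex $v$ let $N[v]$ be its closed neighborhood. Define relations $\le_\alpha$ ($\alpha<\omega(G)$) on $V(G)$ by: $u\le_0 v$ iff $u=v$; and $u\le_\alpha v$ iff for every $x\in N[u]$ there is $y\in N[v]$ and $\gamma<\alpha$ with $x\le_\gamma y$. Let $\eta(u,v)$ be the least ordinal $\alpha$ with $u\le_\alpha v$ (for finite values this is the time for a cop at $v$ to catch a robber at $u$ with the robber moving first, under optimal play). Let $\eta(v)$ be the least ordinal $\alpha$ such that $u\le_\alpha v$ for all $u\in V(G)$, and $\rho(G)=\sup_{v\in V(G)}\eta(v)$. An ordinal is a CR-ordinal if it equals $\rho(G)$ for some cop-win graph $G$. *)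

(* Defs.v *)
From mathcomp Require Import all_boot.

Set Implicit Arguments.
Unset Strict Implicit.
Unset Printing Implicit Defensive.

(** An ordinal is presented by a well-founded tree: [osup f] denotes the least
    ordinal strictly above every [f i].  Distinct trees may denote the same
    ordinal; equality of ordinals is [oeq], not Leibniz equality. *)

Inductive Ord : Type := osup (A : Type) (f : A -> Ord).

Fixpoint ole (a b : Ord) {struct a} : Prop :=
  match a, b with
  | osup A f, osup B g => forall i : A, exists j : B, ole (f i) (g j)
  end.

Definition olt (a b : Ord) : Prop :=
  match b with osup B g => exists j : B, ole a (g j) end.

Definition oeq (a b : Ord) : Prop := ole a b /\ ole b a.

Definition ozero : Ord := osup (fun e : Empty_set => match e with end).

Definition osucc (a : Ord) : Ord := osup (fun _ : unit => a).

Fixpoint ofinite (n : nat) : Ord :=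
  if n is m.+1 then osucc (ofinite m) else ozero.

Definition omega : Ord := osup ofinite.

Definition oleast (P : Ord -> Prop) (a : Ord) : Prop :=
  P a /\ forall b, P b -> ole a b.

Definition is_sup (A : Type) (f : A -> Ord) (a : Ord) : Prop :=
  oleast (fun b => forall i, ole (f i) b) a.

Record wellorder (T : Type) := Wellorder {
  wo_lt :> T -> T -> Prop;
  wo_wf : well_founded wo_lt;
  wo_trans : forall x y z, wo_lt x y -> wo_lt y z -> wo_lt x z;
  wo_total : forall x y, wo_lt x y \/ x = y \/ wo_lt y x
}.

Fixpoint rank (T : Type) (R : T -> T -> Prop) (x : T) (acc : Acc R x)
    {struct acc} : Ord :=
  match acc with
  | Acc_intro h => osup (fun y : {y : T | R y x} => rank (h _ (proj2_sig y)))
  end.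

Definition order_type (T : Type) (R : wellorder T) : Ord :=
  osup (fun x : T => rank (wo_wf R x)).

Record graph := Graph {
  vertex :> Type;
  adj : vertex -> vertex -> Prop;
  adj_sym : forall x y, adj x y -> adj y x;
  adj_irrefl : forall x, ~ adj x x
}.

(** [closed_nbr v x] is x \in N[v]. *)
Definition closed_nbr (G : graph) (v x : G) : Prop := x = v \/ adj v x.

(** A strategy answers each list [:: r_0; ...; r_(n-1)] of the robber's
    positions so far with the cop's position c_n; in particular c_0 = s [::].
    The cop's own past moves are determined by [s], so this is a strategy with
    full memory. *)
Definition cop_strategy (G : graph) : Type := seq G -> G.

Definition robber_play (G : graph) (r : nat -> G) : Prop :=
  forall n, closed_nbr (r n) (r n.+1).

(** The order of the moves is c_0, r_0, c_1, r_1, ... *)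
Definition cop_pos (G : graph) (s : cop_strategy G) (r : nat -> G) (n : nat) : G :=
  s (mkseq r n).

Definition legal_strategy (G : graph) (s : cop_strategy G) : Prop :=
  forall r, robber_play r ->
  forall n, closed_nbr (cop_pos s r n) (cop_pos s r n.+1).

Definition winning_strategy (G : graph) (s : cop_strategy G) : Prop :=
  forall r, robber_play r -> exists n, cop_pos s r n.+1 = r n.

Definition cop_win (G : graph) : Prop :=
  exists s : cop_strategy G, legal_strategy s /\ winning_strategy s.

(** The least ordinal above all finite ordinals and all order types of
    well-orderings of V(G).  If G has cardinality aleph_b, this is omega_(b+1);
    if G is finite, it is omega. *)
Definition omega_of (G : graph) : Ord :=
  osup (fun i : nat + wellorder G =>
    match i with inl n => ofinite n | inr R => order_type R end).

(** [cr_le a u v] is u <=_a v.  The definition is by transfinite recursion on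
    [a]: since [olt] is well-founded, the inductive predicate is the unique
    solution of the recursive clauses. *)
Inductive cr_le (G : graph) : Ord -> G -> G -> Prop :=
| cr_le_zero (a : Ord) (u : G) : oeq a ozero -> cr_le a u u
| cr_le_pos (a : Ord) (u v : G) :
    olt ozero a ->
    (forall x, closed_nbr u x ->
       exists y, closed_nbr v y /\ exists c, olt c a /\ cr_le c x y) ->
    cr_le a u v.

(** [is_eta v a] is "eta(v) exists and equals a". *)
Definition is_eta (G : graph) (v : G) (a : Ord) : Prop :=
  oleast (fun b => olt b (omega_of G) /\ forall u : G, cr_le b u v) a.

(** [is_rho G a] is "every eta(v) exists, and rho(G) = a". *)
Definition is_rho (G : graph) (a : Ord) : Prop :=
  exists eta : G -> Ord, (forall v, is_eta v (eta v)) /\ is_sup eta a.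

Definition CR_ordinal (a : Ord) : Prop :=
  exists G : graph, cop_win G /\ is_rho G a.

Definition gridV : Type := {p : nat * nat | p != (0, 0)}.

Definition grid_adj (u v : gridV) : Prop :=
  let: (a, b) := val u in
  let: (c, d) := val v in
  u <> v /\
  ((a = 0 /\ c = 0) \/ (b = 0 /\ d = 0) \/ (a < c /\ b > d) \/ (a > c /\ b < d)).

Lemma grid_adj_sym (u v : gridV) : grid_adj u v -> grid_adj v u.
Proof.
rewrite /grid_adj; case: (val u) => a b; case: (val v) => c d [uv H].
by split; [move=> vu; apply: uv | tauto].
Qed.

Lemma grid_adj_irrefl (u : gridV) : ~ grid_adj u u.
Proof. by rewrite /grid_adj; case: (val u) => a b []. Qed.

Definition grid_graph : graph := Graph grid_adj_sym grid_adj_irrefl.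

(* Main.v *)
Require Import Defs.
From mathcomp Require Import all_boot.
From mathcomp Require Import zify.

(** Against a robber at [(p, q)], a cop at [(0, m)] with [q < m] controls every
    vertex except the [(p', q')] with [p' > 0] and [q' >= m]; the robber can only
    reach such a vertex with [p' < p], and the cop then slides up to
    [(0, q'.+1)].  So the robber is caught in about [p] rounds, and since the cop
    can reach such an [(0, m)] from anywhere, every eta(v) is at most omega.
    Conversely, if [p, q > n] and the cop is elsewhere, the robber can step out
    of the cop's closed neighbourhood losing only one unit in one coordinate
    (and making the other as large as needed), so he survives [n] rounds. *)

Section Ordinals.

Lemma ole_refl (a : Ord) : ole a a.
Proof. by elim: a => A f IH /= i; exists i. Qed.

Lemma ole_trans (a b c : Ord) : ole a b -> ole b c -> ole a c.
Proof.
elim: a b c => A f IH [B g] [C h] /= ab bc i.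
have [j fg] := ab i; have [k gh] := bc j.
by exists k; apply: IH gh.
Qed.

Lemma osucc_ole (a b : Ord) : ole (osucc a) b <-> olt a b.
Proof. by case: b => B g /=; split=> [/(_ tt) | ab _]. Qed.

(** Two strict steps gain a full unit; this turns each evaded round into one more unit in the lower
    bound. *)
Lemma olt_succ_trans (a b c : Ord) : olt a b -> olt b c -> olt (osucc a) c.
Proof.
case: c => C h /osucc_ole ab [k bh].
by exists k; apply: ole_trans bh.
Qed.

Lemma ole_ofinite (m n : nat) : m <= n -> ole (ofinite m) (ofinite n).
Proof.
elim: m n => [|m IH] [|n] // mn; first by case.
by apply/osucc_ole; exists tt; apply: IH.
Qed.

Lemma olt_ofinite (m n : nat) : m < n -> olt (ofinite m) (ofinite n).
Proof. by move=> mn; apply/osucc_ole/(ole_ofinite m.+1). Qed.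

Lemma olt_ofinite_omega (n : nat) : olt (ofinite n) omega.
Proof. by exists n; apply: ole_refl. Qed.

Lemma omega_ole (b : Ord) : (forall n, olt (ofinite n) b) -> ole omega b.
Proof. by case: b. Qed.

End Ordinals.

Section Grid.

Implicit Types (u v x y : grid_graph) (p q : nat * nat).

(** A boolean test on coordinates, so that [lia] can settle the cases and [cop_step] can branch on
    it. *)
Definition grid_nbr p q : bool :=
  [|| (p.1 == q.1) && (p.2 == q.2), (p.1 == 0) && (q.1 == 0),
      (p.2 == 0) && (q.2 == 0), (p.1 < q.1) && (q.2 < p.2)
    | (q.1 < p.1) && (p.2 < q.2)].

Lemma grid_nbrP u x : reflect (closed_nbr u x) (grid_nbr (val u) (val x)).
Proof.
have [-> | /eqP neq] := eqVneq (x : gridV) u.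
  by rewrite /grid_nbr !eqxx; apply: ReflectT; left.
case: u x neq => [[a b] pu] [[c d] px] neq.
have neq_val : (c, d) != (a, b) by apply/eqP => e; apply/neq/val_inj.
move: neq_val; rewrite xpair_eqE => neq_val.
apply: (iffP idP) => [H | [// | [_ H]]]; last by rewrite /grid_nbr /=; lia.
right; split; first by move=> ux; apply: neq.
by move: H neq_val; rewrite /grid_nbr /=; lia.
Qed.

Definition left_vertex (m : nat) : grid_graph :=
  exist (fun p => p != (0, 0)) (0, m.+1) isT.

Definition right_vertex (a b : nat) : grid_graph :=
  exist (fun p => p != (0, 0)) (a.+1, b) isT.

Lemma left_nbr v m : (val v).2 <= m -> closed_nbr v (left_vertex m).
Proof.
by move=> vm; apply/grid_nbrP; move: vm; rewrite /grid_nbr /=; lia.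
Qed.

Lemma left_left_nbr v m : (val v).1 = 0 -> closed_nbr v (left_vertex m).
Proof. by move=> v0; apply/grid_nbrP; rewrite /grid_nbr v0 /=; lia. Qed.

(** Outside the closed neighbourhood of [(0, m.+1)] the second coordinate exceeds [m], so the robber
    moves up, and a move up to a positive column goes left. *)
Lemma left_escape u x m :
  closed_nbr u x -> (val u).2 <= m -> ~ closed_nbr (left_vertex m) x ->
  (val x).1 < (val u).1.
Proof.
by move=> /grid_nbrP ux um /grid_nbrP; move: ux um; rewrite /grid_nbr /=; lia.
Qed.

Lemma left_capture u m :
  (val u).2 <= m -> cr_le (ofinite (val u).1.+1) u (left_vertex m).
Proof.
have [k] := ubnP (val u).1; elim: k u m => // k IH u m uk um.
apply: cr_le_pos => [|x ux]; first exact: (olt_ofinite 0).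
have [mx | /grid_nbrP mx] := boolP (grid_nbr (val (left_vertex m)) (val x)).
  exists x; split; first exact/grid_nbrP.
  exists ozero; split; first exact: (olt_ofinite 0).
  by apply: cr_le_zero; split; apply: ole_refl.
have xu := left_escape _ _ _ ux um mx.
exists (left_vertex (val x).2); split; first exact: left_left_nbr.
exists (ofinite (val x).1.+1); split; first exact: olt_ofinite.
by apply: IH => //; lia.
Qed.

Lemma cr_le_omega u v : cr_le omega u v.
Proof.
apply: cr_le_pos => [|x _]; first exact: (olt_ofinite_omega 0).
(* High enough both to be reachable from [v] and to dominate [x]. *)
exists (left_vertex (maxn (val v).2 (val x).2)); split.
  by apply: left_nbr; rewrite leq_maxl.
exists (ofinite (val x).1.+1); split; first exact: olt_ofinite_omega.
by apply: left_capture; rewrite leq_maxr.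
Qed.

(** Distinct vertices comparable in the product order, one having both coordinates positive and
    being moreover [x], are not adjacent. So [x] is taken above [v] on the upper left or lower right
    of [u], or is [u] itself when [u] lies below [v]. *)
Lemma robber_escape n u v :
  n.+1 < (val u).1 -> n.+1 < (val u).2 -> u <> v ->
  exists x, [/\ closed_nbr u x, ~ closed_nbr v x, n < (val x).1 & n < (val x).2].
Proof.
case: u v => [[a b] pu] [[c d] pv] /= u1 u2 uv.
have neq : (a, b) != (c, d) by apply/eqP => e; apply/uv/val_inj.
move: neq; rewrite xpair_eqE => neq.
have [ca | ac] := ltnP c a; last have [db | bd] := ltnP d b.
- exists (right_vertex a.-2 (b + d).+1).
  by split; [apply/grid_nbrP | apply/grid_nbrP | |]; rewrite /grid_nbr /=; lia.
- exists (right_vertex (a + c) b.-1).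
  by split; [apply/grid_nbrP | apply/grid_nbrP | |]; rewrite /grid_nbr /=; lia.
- exists (exist _ (a, b) pu).
  by split; [apply/grid_nbrP | apply/grid_nbrP | |]; rewrite /grid_nbr /=; lia.
Qed.

Lemma cr_le_lower_bound n b u v :
  n < (val u).1 -> n < (val u).2 -> u <> v -> cr_le b u v -> olt (ofinite n) b.
Proof.
elim: n b u v => [|n IH] b u v u1 u2 uv ruv.
  by case: ruv uv.
have [x [ux vx x1 x2]] := robber_escape _ _ _ u1 u2 uv.
case: ruv uv ux vx => [a w _ // | a w z _ step _ wx zx].
have [y [zy [c [ca rxy]]]] := step _ wx.
(* The reply [y] lies in the closed neighbourhood of [v] and [x] does not, so they differ. *)
apply: olt_succ_trans ca; apply: (IH _ x y) => // xy.
by apply: zx; rewrite xy.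
Qed.

(** Serves only to place [omega] below [omega_of]: column 0 is an initial segment of type
    [omega]. *)
Definition grid_lex (u v : gridV) : Prop :=
  (val u).1 < (val v).1 \/ (val u).1 = (val v).1 /\ (val u).2 < (val v).2.

Lemma grid_lex_wf : well_founded grid_lex.
Proof.
suff acc a b v : (val v).1 < a -> (val v).2 < b -> Acc grid_lex v.
  by move=> v; exact: acc (ltnSn _) (ltnSn _).
elim: a b v => [b v|a IHa b]; first by rewrite ltn0.
elim: b => [v|b IHb v va vb]; first by rewrite ltn0.
constructor=> u [uv | [uv1 uv2]]; last by apply: IHb; lia.
by apply: (IHa (val u).2.+1); lia.
Qed.

Lemma grid_lex_trans x y z : grid_lex x y -> grid_lex y z -> grid_lex x z.
Proof. by rewrite /grid_lex; lia. Qed.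

Lemma grid_lex_total x y : grid_lex x y \/ x = y \/ grid_lex y x.
Proof.
have [-> | xy] := eqVneq (x : gridV) y; first by right; left.
have : val x != val y by rewrite (inj_eq val_inj).
rewrite /grid_lex; case: (val x) (val y) => [a b] [c d] /=.
by rewrite xpair_eqE; lia.
Qed.

Definition grid_wellorder : wellorder grid_graph :=
  Wellorder grid_lex_wf grid_lex_trans grid_lex_total.

Lemma rank_left_vertex n (acc : Acc grid_lex (left_vertex n)) :
  ole (ofinite n) (rank acc).
Proof.
elim: n acc => [|n IH] [h]; first by case.
have lt : grid_lex (left_vertex n) (left_vertex n.+1) by right.
by move=> _ /=; exists (exist _ (left_vertex n) lt); apply: IH.
Qed.

Lemma omega_lt_omega_of_grid : olt omega (omega_of grid_graph).
Proof.
exists (inr grid_wellorder) => n /=; exists (left_vertex n).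
exact: rank_left_vertex.
Qed.

Lemma is_eta_grid v : is_eta v omega.
Proof.
split; first by split; [apply: omega_lt_omega_of_grid | move=> u; apply: cr_le_omega].
move=> b [_ rb]; apply: omega_ole => n.
(* This start has both coordinates above [n] and lies strictly to the right of [v]. *)
apply: (cr_le_lower_bound n b (right_vertex (n + (val v).1) n.+1) v _ _ _ (rb _)) => /=; try lia.
by move=> /(congr1 (fun w : grid_graph => (val w).1)) /=; lia.
Qed.

Lemma is_rho_grid : is_rho grid_graph omega.
Proof.
exists (fun=> omega); split; first exact: is_eta_grid.
by split=> [_ | b /(_ (left_vertex 0))]; first exact: ole_refl.
Qed.

Definition cop_step (c r : grid_graph) : grid_graph :=
  if grid_nbr (val c) (val r) then r else left_vertex (val r).2.

Definition grid_strategy : cop_strategy grid_graph :=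
  foldl cop_step (left_vertex 0).

Lemma cop_posS (r : nat -> grid_graph) n :
  cop_pos grid_strategy r n.+1 = cop_step (cop_pos grid_strategy r n) (r n).
Proof. by rewrite /cop_pos /grid_strategy mkseqS foldl_rcons. Qed.

(* Play continues after a capture; the cop then just shadows the robber. *)
Lemma cop_pos_left_or_shadow (r : nat -> grid_graph) n :
  (val (cop_pos grid_strategy r n)).1 = 0 \/
  exists2 m, n = m.+1 & cop_pos grid_strategy r n = r m.
Proof.
case: n => [|n]; first by left.
rewrite cop_posS /cop_step; case: ifP => _; last by left.
by right; exists n.
Qed.

Lemma grid_strategy_legal : legal_strategy grid_strategy.
Proof.
move=> r rplay n; rewrite cop_posS /cop_step.
case: ifPn => [/grid_nbrP // | /grid_nbrP far].
case: (cop_pos_left_or_shadow r n) => [c0 | [m nm cr]].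
  exact: left_left_nbr.
(* A shadowing cop stands on the robber's previous vertex, so the robber is within reach. *)
by case: far; rewrite cr nm.
Qed.

Lemma grid_strategy_winning : winning_strategy grid_strategy.
Proof.
move=> r rplay.
(* Induction on a bound [k] for the robber's column; at [k = 0] both players are in column 0, a
   clique. *)
suff win k n : (val (cop_pos grid_strategy r n)).1 = 0 -> (val (r n)).1 <= k ->
    exists n, cop_pos grid_strategy r n.+1 = r n.
  exact: (win (val (r 0)).1 0).
elim: k n => [|k IH] n c0 rk.
  exists n; rewrite cop_posS /cop_step /grid_nbr c0.
  by move: rk; rewrite leqn0 => /eqP ->; rewrite !orbT.
have := cop_posS r n; rewrite /cop_step.
case: ifP => [_ cr | _ cS]; first by exists n.
have [nbr | /grid_nbrP far] :=
  boolP (grid_nbr (val (cop_pos grid_strategy r n.+1)) (val (r n.+1))).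
  by exists n.+1; rewrite cop_posS /cop_step nbr.
apply: (IH n.+1); first by rewrite cS.
rewrite cS in far.
by have := left_escape _ _ _ (rplay n) (leqnn _) far; lia.
Qed.

Lemma cop_win_grid : cop_win grid_graph.
Proof.
exists grid_strategy.
by split; [apply: grid_strategy_legal | apply: grid_strategy_winning].
Qed.

End Grid.

Theorem theorem3 :
  cop_win grid_graph /\ is_rho grid_graph omega /\ CR_ordinal omega.
Proof.
split; first exact: cop_win_grid.
split; first exact: is_rho_grid.
by exists grid_graph; split; [apply: cop_win_grid | apply: is_rho_grid].
Qed.
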